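(* Let $A$ be a symmetric $n\times n$-matrix (with real or complex entries). For $I\subseteq [n]=\{1,2,\ldots,n\}$ let $A_I$ denote the principal minor of $A$ with rows and columns indexed by $I$, with $A_\emptyset=1$. Then the vector $A_*=(A_I)_{I\subseteq[n]}$ satisfies all hyperdeterminantal relations (of format $2\times2\times2$); that is, for every subset $I\subset[n]$ and all distinct $j_1,j_2,j_3\in[n]\setminus I$, $$H\bigl(A_{I},A_{I\cup\{j_1\}},A_{I\cup\{j_2\}},A_{I\cup\{j_3\}},A_{I\cup\{j_1,j_2\}},A_{I\cup\{j_1,j_3\}},A_{I\cup\{j_2,j_3\}},A_{I\cup\{j_1,j_2,j_3\}}\bigr)=0,$$ where $H$ is the $2\times2\times2$-hyperdeterminant polynomial.
   Context: The $2\times 2\times 2$-hyperdeterminant is the polynomial in eight variables $$\begin{aligned}H(b_\emptyset,b_1,b_2,b_3,b_{12},b_{13},b_{23},b_{123})={}&b_\emptyset^2b_{123}^2+b_1^2b_{23}^2+b_2^2b_{13}^2+b_3^2b_{12}^2+4b_\emptyset b_{12}b_{13}b_{23}+4b_1b_2b_3b_{123}\\&-2b_\emptyset b_1b_{23}b_{123}-2b_\emptyset b_2b_{13}b_{123}-2b_\emptyset b_3b_{12}b_{123}\\&-2b_1b_2b_{13}b_{23}-2b_1b_3b_{12}b_{23}-2b_2b_3b_{12}b_{13}.\end{aligned}$$ *)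

(* Defs.v *)
From HB Require Import structures.
From mathcomp Require Import all_boot all_order all_algebra.

Set Implicit Arguments.
Unset Strict Implicit.
Unset Printing Implicit Defensive.

Import GRing.Theory.
Local Open Scope ring_scope.

Definition hyperdet222 (K : comNzRingType) (b0 b1 b2 b3 b12 b13 b23 b123 : K)
  : K :=
  b0 ^+ 2 * b123 ^+ 2 + b1 ^+ 2 * b23 ^+ 2
  + b2 ^+ 2 * b13 ^+ 2 + b3 ^+ 2 * b12 ^+ 2
  + 4%:R * b0 * b12 * b13 * b23 + 4%:R * b1 * b2 * b3 * b123
  - 2%:R * b0 * b1 * b23 * b123
  - 2%:R * b0 * b2 * b13 * b123
  - 2%:R * b0 * b3 * b12 * b123
  - 2%:R * b1 * b2 * b13 * b23
  - 2%:R * b1 * b3 * b12 * b23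
  - 2%:R * b2 * b3 * b12 * b13.

(* [enum_val : 'I_#|I| -> 'I_n] lists the elements of I, so the submatrix keeps
   exactly the rows and columns indexed by I.  For I = set0 it is a 0 x 0
   matrix, whose determinant is 1. *)
Definition principal_minor (K : comNzRingType) (n : nat) (A : 'M[K]_n)
    (I : {set 'I_n}) : K :=
  \det (mxsub (fun i : 'I_#|I| => enum_val i) (fun i : 'I_#|I| => enum_val i) A).

Definition principal_minors (K : comNzRingType) (n : nat) (A : 'M[K]_n)
  : {ffun {set 'I_n} -> K} :=
  [ffun I => principal_minor A I].

Definition hyperdet_relations (K : comNzRingType) (n : nat)
    (a : {ffun {set 'I_n} -> K}) : Prop :=
  forall (I : {set 'I_n}) (j1 j2 j3 : 'I_n),
    j1 \notin I -> j2 \notin I -> j3 \notin I ->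
    j1 != j2 -> j1 != j3 -> j2 != j3 ->
    hyperdet222 (a I)
      (a (I :|: [set j1])) (a (I :|: [set j2])) (a (I :|: [set j3]))
      (a (I :|: [set j1; j2])) (a (I :|: [set j1; j3]))
      (a (I :|: [set j2; j3])) (a (I :|: [set j1; j2; j3])) = 0.

(* Main.v *)
Require Import Defs.
From HB Require Import structures.
From mathcomp Require Import all_boot all_order all_fingroup all_algebra.
From mathcomp Require Import reals complex.
From mathcomp Require Import ring.

(** The principal minors of a symmetric matrix [A] indexed by supersets of [I]
    are governed by the Schur complement [S] of [A_I]: when [A_I] is a nonzero
    element of a field, the minor on the disjoint union of [I] and [J] is [A_I]
    times the minor of [S] on [J] ([principal_minor_schur]).  As the
    hyperdeterminant is homogeneous, its vanishing reduces to a statement on the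
    principal minors of a symmetric 3 x 3 matrix, which is a polynomial identity
    in its six entries ([hyperdet222_sym3]).

    If [A_I] vanishes there is no Schur complement, so [A] is first deformed to
    [A + 'X] over [{poly K}].  The principal minors of the deformed matrix are
    characteristic polynomials, hence monic and nonzero, and the previous
    argument applies to it in the fraction field of [{poly K}].  The
    hyperdeterminant being a polynomial, the relation holds already in
    [{poly K}], and evaluation at [0] gives it for [A]
    ([hyperdet_relations_sym]). *)

Set Implicit Arguments.
Unset Strict Implicit.
Unset Printing Implicit Defensive.

Import GRing.Theory.
Local Open Scope ring_scope.

Section Minors.
Variables (K : comNzRingType) (n : nat).
Implicit Types (A : 'M[K]_n) (I : {set 'I_n}).

(** Two enumerations of [I] differ by a permutation, which acts on rows and
    columns at once, so that its sign contributes a square. *)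
Lemma principal_minor_reindex A I m (f : 'I_m -> 'I_n) :
  injective f -> f @: 'I_m = I -> \det (mxsub f f A) = principal_minor A I.
Proof.
move=> f_inj fI.
have mE : m = #|I| by rewrite -fI card_imset // card_ord.
subst m.
have fP i : f i \in I by rewrite -fI imset_f.
pose s i := enum_rank_in (fP i) (f i).
have sK i : enum_val (s i) = f i by rewrite enum_rankK_in.
have s_inj : injective s by move=> i j /(congr1 enum_val); rewrite !sK => /f_inj.
pose B := mxsub (@enum_val _ (mem I)) (@enum_val _ (mem I)) A.
have -> : mxsub f f A = row_perm (perm s_inj) (col_perm (perm s_inj) B).
  by apply/matrixP=> i j; rewrite !mxE !permE !sK.
rewrite row_permE col_permE !det_mulmx !det_perm odd_permV.
by rewrite mulrCA -signr_addb addbb mulr1.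
Qed.

End Minors.

Lemma principal_minor_map (K L : comNzRingType) (phi : {rmorphism K -> L}) n
    (A : 'M[K]_n) I :
  principal_minor (map_mx phi A) I = phi (principal_minor A I).
Proof. by rewrite /principal_minor -map_mxsub det_map_mx. Qed.

Lemma hyperdet222_map (K L : comNzRingType) (phi : {rmorphism K -> L})
    b0 b1 b2 b3 b12 b13 b23 b123 :
  hyperdet222 (phi b0) (phi b1) (phi b2) (phi b3)
    (phi b12) (phi b13) (phi b23) (phi b123)
  = phi (hyperdet222 b0 b1 b2 b3 b12 b13 b23 b123).
Proof.
by rewrite /hyperdet222 !(rmorph_nat, rmorphXn, rmorphM, rmorphB, rmorphD).
Qed.

Lemma det_schur (F : fieldType) m k (M : 'M[F]_m) (B : 'M_(m, k))
    (C : 'M_(k, m)) (D : 'M_k) :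
  M \in unitmx ->
  \det (block_mx M B C D) = \det M * \det (D - C *m invmx M *m B).
Proof.
move=> Mu.
have -> : block_mx M B C D =
    block_mx 1%:M 0 (C *m invmx M) 1%:M
    *m block_mx M B 0 (D - C *m invmx M *m B).
  rewrite mulmx_block !mul1mx !mul0mx !addr0 mulmxKV //.
  by rewrite addrC subrK.
by rewrite det_mulmx det_lblock det_ublock !det1 !mul1r.
Qed.

(** Entries are indexed by all of ['I_n], so that a single matrix serves every
    set disjoint from [I]; if [A_I] is invertible, those with an index in [I]
    vanish. *)
Definition schur_complement (F : fieldType) n (A : 'M[F]_n) (I : {set 'I_n}) :
    'M[F]_n :=
  let e := fun i : 'I_#|I| => enum_val i in
  A - colsub e A *m invmx (mxsub e e A) *m rowsub e A.

Section Schur.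
Variables (F : fieldType) (n : nat) (A : 'M[F]_n) (I : {set 'I_n}).

Lemma principal_minor_schur k (t : k.-tuple 'I_n) :
    principal_minor A I != 0 -> uniq t -> all [predC I] t ->
  principal_minor A (I :|: [set x in t]) =
  principal_minor A I *
    \det (mxsub (tnth t) (tnth t) (schur_complement A I)).
Proof.
move=> AI_neq0 t_uniq /allP tNI.
pose e := fun i : 'I_#|I| => enum_val i.
(* Listing [I] first and [t] next puts the submatrix in block form. *)
pose f (i : 'I_(#|I| + k)) :=
  match split i with inl a => e a | inr b => tnth t b end.
have fl a : f (lshift k a) = e a by rewrite /f (unsplitK (inl a)).
have fr b : f (rshift #|I| b) = tnth t b by rewrite /f (unsplitK (inr b)).
have eNt a b : e a <> tnth t b.
  by move=> eq_ab; have /negP[] := tNI _ (mem_tnth b t); rewrite -eq_ab enum_valP.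
have f_inj : injective f.
  move=> i j; case: (split_ordP i) => a ->; case: (split_ordP j) => b ->.
  - by rewrite !fl => /enum_val_inj->.
  - by rewrite fl fr => /eNt.
  - by rewrite fl fr => /esym/eNt.
  - by rewrite !fr => /(tuple_uniqP _ t_uniq)->.
have fI : f @: 'I_(#|I| + k) = I :|: [set x in t].
  apply/setP=> x; rewrite !inE; apply/imsetP/orP.
    case=> i _ ->; case: (split_ordP i) => a ->; rewrite ?fl ?fr.
      by left; apply: enum_valP.
    by right; apply: mem_tnth.
  case=> [xI|/tnthP[b ->]]; last by exists (rshift _ b); rewrite ?fr.
  by exists (lshift k (enum_rank_in xI x)); rewrite // fl /e enum_rankK_in.
rewrite -(principal_minor_reindex A f_inj fI).
have -> : mxsub f f A =
    block_mx (mxsub e e A) (mxsub e (tnth t) A)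
             (mxsub (tnth t) e A) (mxsub (tnth t) (tnth t) A).
  apply/matrixP=> i j; rewrite mxE.
  by case: (split_ordP i) => a ->; case: (split_ordP j) => b ->;
    rewrite ?(block_mxEul, block_mxEur, block_mxEdl, block_mxEdr) ?fl ?fr mxE.
rewrite det_schur; last by rewrite unitmxE unitfE.
congr (_ * \det _); apply/matrixP=> i j; rewrite !mxE; congr (_ - _).
apply: eq_bigr => a _; rewrite !mxE; congr (_ * _).
by apply: eq_bigr => b _; rewrite !mxE.
Qed.

Lemma schur_complement_sym : A^T = A ->
  (schur_complement A I)^T = schur_complement A I.
Proof.
move=> AT; rewrite /schur_complement linearB /= !trmx_mul trmx_inv mulmxA.
by rewrite !trmx_mxsub AT.
Qed.

End Schur.

Lemma det_mxsub2 (K : comNzRingType) n (S : 'M[K]_n) a b :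
  \det (mxsub (tnth [tuple a; b]) (tnth [tuple a; b]) S) =
  S a a * S b b - S a b * S b a.
Proof.
rewrite (expand_det_row _ ord0) !big_ord_recl big_ord0 /cofactor !det_mx11.
by rewrite !mxE !(tnth_nth a) /= expr0 expr1; ring.
Qed.

Lemma det_mxsub3 (K : comNzRingType) n (S : 'M[K]_n) a b c :
  \det (mxsub (tnth [tuple a; b; c]) (tnth [tuple a; b; c]) S) =
  S a a * (S b b * S c c - S b c * S c b)
  - S a b * (S b a * S c c - S b c * S c a)
  + S a c * (S b a * S c b - S b b * S c a).
Proof.
rewrite (expand_det_row _ ord0) !big_ord_recl big_ord0 /cofactor.
rewrite !(expand_det_row _ ord0) !big_ord_recl !big_ord0 /cofactor !det_mx11.
by rewrite !mxE !(tnth_nth a) /=; ring.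
Qed.

(** Here [d] stands for [A_I], and [a], [b], [c], [x], [y], [z] for the entries
    11, 22, 33, 12, 13, 23 of its Schur complement, whose determinant, expanded
    along the first row, is the last factor. *)
Lemma hyperdet222_sym3 (K : comNzRingType) (d a b c x y z : K) :
  hyperdet222 d (d * a) (d * b) (d * c)
    (d * (a * b - x * x)) (d * (a * c - y * y)) (d * (b * c - z * z))
    (d * (a * (b * c - z * z) - x * (x * c - z * y) + y * (x * z - b * y))) = 0.
Proof. rewrite /hyperdet222; ring. Qed.

Lemma hyperdet_relation_neq0 (F : fieldType) n (A : 'M[F]_n)
    (I : {set 'I_n}) j1 j2 j3 : A^T = A -> principal_minor A I != 0 ->
    j1 \notin I -> j2 \notin I -> j3 \notin I ->
    j1 != j2 -> j1 != j3 -> j2 != j3 ->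
  let a := principal_minor A in
  hyperdet222 (a I)
    (a (I :|: [set j1])) (a (I :|: [set j2])) (a (I :|: [set j3]))
    (a (I :|: [set j1; j2])) (a (I :|: [set j1; j3]))
    (a (I :|: [set j2; j3])) (a (I :|: [set j1; j2; j3])) = 0.
Proof.
move=> AT AI_neq0 j1I j2I j3I j12 j13 j23 /=.
pose S := schur_complement A I.
have ST : S^T = S := schur_complement_sym I AT.
have SE i j : S j i = S i j by rewrite -{1}ST mxE.
have minor1 i : i \notin I ->
    principal_minor A (I :|: [set i]) = principal_minor A I * S i i.
  move=> iI; have -> : [set i] = [set x in [tuple i]].
    by apply/setP=> x; rewrite !inE.
  by rewrite principal_minor_schur //= ?iI // det_mx11 !mxE !(tnth_nth i).
have minor2 i j : i \notin I -> j \notin I -> i != j ->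
    principal_minor A (I :|: [set i; j]) =
    principal_minor A I * (S i i * S j j - S i j * S i j).
  move=> iI jI ij; have -> : [set i; j] = [set x in [tuple i; j]].
    by apply/setP=> x; rewrite !inE.
  rewrite principal_minor_schur //= ?inE ?iI ?jI ?ij //.
  by rewrite det_mxsub2 -/S (SE i j).
have minor3 : principal_minor A (I :|: [set j1; j2; j3]) =
    principal_minor A I * (S j1 j1 * (S j2 j2 * S j3 j3 - S j2 j3 * S j2 j3)
      - S j1 j2 * (S j1 j2 * S j3 j3 - S j2 j3 * S j1 j3)
      + S j1 j3 * (S j1 j2 * S j2 j3 - S j2 j2 * S j1 j3)).
  have -> : [set j1; j2; j3] = [set x in [tuple j1; j2; j3]].
    by apply/setP=> x; rewrite !inE orbA.
  rewrite principal_minor_schur //= ?inE ?j1I ?j2I ?j3I ?negb_or ?j12 ?j13 ?j23 //.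
  by rewrite det_mxsub3 -/S (SE j1 j2) (SE j1 j3) (SE j2 j3).
by rewrite !minor1 // !minor2 // minor3; apply: hyperdet222_sym3.
Qed.

(** The minor is the characteristic polynomial of [- A_I]. *)
Lemma principal_minor_shift_neq0 (K : comNzRingType) n (A : 'M[K]_n) I :
  principal_minor (map_mx polyC A + 'X%:M) I != 0.
Proof.
apply: monic_neq0; rewrite /principal_minor.
set e := fun i : 'I_#|I| => enum_val i.
have -> : mxsub e e (map_mx polyC A + 'X%:M) = char_poly_mx (- mxsub e e A).
  apply/matrixP=> i j; rewrite !mxE rmorphN opprK addrC.
  by rewrite /e (inj_eq enum_val_inj).
exact: char_poly_monic.
Qed.

(** The minor on [I] may vanish for [A], but never does for the deformation
    [A + 'X], which specializes to [A] at [0]. *)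
Theorem hyperdet_relations_sym (K : idomainType) n (A : 'M[K]_n) :
  A^T = A -> hyperdet_relations (principal_minors A).
Proof.
move=> AT I j1 j2 j3 j1I j2I j3I j12 j13 j23.
pose A' := map_mx polyC A + 'X%:M.
have A'T : A'^T = A' by rewrite /A' linearD /= map_trmx AT tr_scalar_mx.
have A'0 : A = map_mx (horner_eval 0) A'.
  apply/matrixP=> i j; rewrite !mxE /horner_eval hornerD hornerC hornerMn.
  by rewrite hornerX mul0rn addr0.
rewrite A'0 !ffunE !principal_minor_map hyperdet222_map.
(* The relation now has to be shown for [A'] before evaluation; it can be
   checked in the fraction field, into which [{poly K}] embeds. *)
set H := hyperdet222 _ _ _ _ _ _ _ _; suff -> : H = 0 by rewrite rmorph0.
apply/eqP; rewrite -tofrac_eq0 /H -hyperdet222_map; apply/eqP.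
rewrite -!principal_minor_map; apply: hyperdet_relation_neq0 => //.
  by rewrite map_trmx A'T.
by rewrite principal_minor_map tofrac_eq0 principal_minor_shift_neq0.
Qed.

Theorem theorem2 (R : realType) (n : nat) :
  (forall A : 'M[R]_n,
     A \is symmetricmx -> hyperdet_relations (principal_minors A)) /\
  (forall A : 'M[R[i]]_n,
     A \is symmetricmx -> hyperdet_relations (principal_minors A)).
Proof.
have symE (F : fieldType) (A : 'M[F]_n) : A \is symmetricmx -> A^T = A.
  by move=> /is_hermitianmxP; rewrite expr0 scale1r map_mx_id.
by split=> A /symE; apply: hyperdet_relations_sym.
Qed.
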